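(* Let $\mathcal{L}$ be a first-order language, let $\mathcal{M}$ be an $\mathcal{L}$-structure and let $\mathcal{F}\colon \mathcal{L}\mathbf{Str} \to \mathbf{Set}$ be the forgetful functor. The map $$(\operatorname{Quo}_{\mathcal{F}}(\mathcal{M}), \leq) \to (\operatorname{Con}(\mathcal{M}), \subseteq), \qquad [f]_\sim \mapsto \ker f,$$ defines a lattice isomorphism.
   Context: The universe of an $\mathcal{L}$-structure $\mathcal{M}$ is denoted $M$; constants are $0$-ary function symbols. A strong homomorphism $f\colon \mathcal{M} \to \mathcal{N}$ of $\mathcal{L}$-structures is a map $M \to N$ such that $f(F^{\mathcal{M}}(x_1,\dots,x_n)) = F^{\mathcal{N}}(f(x_1),\dots,f(x_n))$ for every $n$-ary function symbol $F$, and $R^{\mathcal{M}}(x_1,\dots,x_n) \iff R^{\mathcal{N}}(f(x_1),\dots,f(x_n))$ for every $n$-ary relation symbol $R$, for all $x_1,\dots,x_n \in M$. The category $\mathcal{L}\mathbf{Str}$ has $\mathcal{L}$-structures as objects and strong homomorphisms as morphisms; $\mathcal{F}\colon \mathcal{L}\mathbf{Str} \to \mathbf{Set}$ sends a structure to its universe. $\operatorname{Epi}_{\mathcal{F}}(\mathcal{M},-)$ is the class of morphisms $f$ in $\mathcal{L}\mathbf{Str}$ with source $\mathcal{M}$ such that $\mathcal{F}(f)$ is an epimorphism in $\mathbf{Set}$ (i.e. surjective strong homomorphisms from $\mathcal{M}$). For $f, g \in \operatorname{Epi}_{\mathcal{F}}(\mathcal{M},-)$, $f \leq g$ means $g = h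 \circ f$ for some strong homomorphism $h$ from the target of $f$ to the target of $g$; $f \sim g$ means $f \leq g$ and $g \leq f$. $\operatorname{Quo}_{\mathcal{F}}(\mathcal{M})$ is the class of $\sim$-equivalence classes, partially ordered by $[f]_\sim \leq [g]_\sim \iff f \leq g$. A congruence on $\mathcal{M}$ is an equivalence relation $\theta$ on $M$ such that whenever $(x_i,y_i) \in \theta$ for $1 \le i \leq n$: $(F^{\mathcal{M}}(x_1,\dots,x_n), F^{\mathcal{M}}(y_1,\dots,y_n)) \in \theta$ for every $n$-ary function symbol $F$, and $R^{\mathcal{M}}(x_1,\dots,x_n) \iff R^{\mathcal{M}}(y_1,\dots,y_n)$ for every $n$-ary relation symbol $R$. $\operatorname{Con}(\mathcal{M})$ is the set of congruences on $\mathcal{M}$, a lattice under inclusion. For a strong homomorphism $f$ with source $\mathcal{M}$, $\ker f = \{\, (x,y) \in M^2 \mid f(x) = f(y) \,\}$, which is a congruence on $\mathcal{M}$. *)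

(* Defs.v *)
From HB Require Import structures.
From mathcomp Require Import all_boot all_order.
From mathcomp Require Import generic_quotient.
From mathcomp Require Import boolp classical_sets.

Set Implicit Arguments.
Unset Strict Implicit.
Unset Printing Implicit Defensive.

Import Order.TTheory.

Local Open Scope classical_set_scope.
Local Open Scope quotient_scope.
Local Open Scope order_scope.

Record language := Language {
  fsym : Type;
  rsym : Type;
  farity : fsym -> nat;
  rarity : rsym -> nat }.

(* The universe may be empty.  The coercion [carrier] is the forgetful functor
   to sets on objects; on morphisms it is the coercion of [shom] to functions. *)
Record Lstr (L : language) := LStr {
  carrier :> Type;
  fint : forall F : fsym L, ('I_(farity F) -> carrier) -> carrier;
  rint : forall R : rsym L, ('I_(rarity R) -> carrier) -> Prop }.

Arguments fint {L} _ F _.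
Arguments rint {L} _ R _.

Definition strong_hom (L : language) (M N : Lstr L) (f : M -> N) : Prop :=
  (forall (F : fsym L) (x : 'I_(farity F) -> M),
      f (fint M F x) = fint N F (fun i => f (x i))) /\
  (forall (R : rsym L) (x : 'I_(rarity R) -> M),
      rint M R x <-> rint N R (fun i => f (x i))).

Record shom (L : language) (M N : Lstr L) := SHom {
  shom_fun :> M -> N;
  shomP : strong_hom shom_fun }.

Section Composition.
Variables (L : language) (M N P : Lstr L).

Lemma strong_hom_id : strong_hom (@idfun M).
Proof. by []. Qed.

Definition shom_id : shom M M := SHom strong_hom_id.

Lemma strong_hom_comp (h : shom N P) (f : shom M N) : strong_hom (h \o f).
Proof.
case: h f => h [hF hR] [f [fF fR]]; split=> [F x | R x] /=.
  by rewrite fF hF.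
by rewrite fR hR.
Qed.

Definition shom_comp (h : shom N P) (f : shom M N) : shom M P :=
  SHom (strong_hom_comp h f).

End Composition.

Definition set_epi (A B : Type) (f : A -> B) : Prop :=
  forall (Z : Type) (g h : B -> Z), g \o f = h \o f -> g = h.

Record epiF (L : language) (M : Lstr L) := EpiF {
  epi_target : Lstr L;
  epi_hom :> shom M epi_target;
  epi_homP : set_epi epi_hom }.

HB.instance Definition _ (L : language) (M : Lstr L) := gen_eqMixin (epiF M).
HB.instance Definition _ (L : language) (M : Lstr L) :=
  gen_choiceMixin (epiF M).

Section Quotients.
Variables (L : language) (M : Lstr L).
Implicit Types f g k : epiF M.

Definition epi_le f g : Prop :=
  exists h : shom (epi_target f) (epi_target g), epi_hom g = shom_comp h f.

Definition epi_sim f g : Prop := epi_le f g /\ epi_le g f.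

Lemma shom_ext (N : Lstr L) (u v : shom M N) : u =1 v -> u = v.
Proof.
case: u v => [u Pu] [v Pv] /= /funext uv; move: Pu Pv.
by rewrite uv => Pu Pv; congr SHom; exact: Prop_irrelevance.
Qed.

Lemma epi_le_refl f : epi_le f f.
Proof. by exists (shom_id _); apply: shom_ext. Qed.

Lemma epi_le_trans g f k : epi_le f g -> epi_le g k -> epi_le f k.
Proof.
move=> [h gE] [h' kE]; exists (shom_comp h' h).
by rewrite kE gE; apply: shom_ext.
Qed.

Definition epi_simb : rel (epiF M) := fun f g => `[< epi_sim f g >].

Lemma epi_simb_refl : reflexive epi_simb.
Proof. by move=> f; apply/asboolP; split; exact: epi_le_refl. Qed.

Lemma epi_simb_sym : symmetric epi_simb.
Proof. by move=> f g; apply/asboolP/asboolP => -[]. Qed.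

Lemma epi_simb_trans : transitive epi_simb.
Proof.
move=> g f k /asboolP[fg gf] /asboolP[gk kg]; apply/asboolP; split.
  exact: epi_le_trans gk.
exact: epi_le_trans gf.
Qed.

Canonical epi_sim_equiv :=
  EquivRel epi_simb epi_simb_refl epi_simb_sym epi_simb_trans.

Definition Quo : Type := {eq_quot epi_sim_equiv}.

HB.instance Definition _ := EqQuotient.on Quo.
HB.instance Definition _ := Choice.on Quo.

(* The order is defined on canonical representatives; [quo_leE] shows that it
   is the order induced by [epi_le] on classes. *)
Definition quo_le : rel Quo := fun p q => `[< epi_le (repr p) (repr q) >].

Lemma quo_piP f g : \pi_Quo f = \pi_Quo g <-> epi_sim f g.
Proof.
split=> [/eqmodP/asboolP // | fg].
by apply/eqmodP/asboolP.
Qed.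

Lemma repr_sim f : epi_sim (repr (\pi_Quo f)) f.
Proof. by apply/quo_piP; rewrite reprK. Qed.

Lemma quo_le_refl : reflexive quo_le.
Proof. by move=> p; apply/asboolP; exact: epi_le_refl. Qed.

Lemma quo_le_anti : antisymmetric quo_le.
Proof.
move=> p q /andP[/asboolP pq /asboolP qp].
by rewrite -[p]reprK -[q]reprK; apply/quo_piP.
Qed.

Lemma quo_le_trans : transitive quo_le.
Proof.
move=> q p r /asboolP pq /asboolP qr; apply/asboolP.
exact: epi_le_trans qr.
Qed.

Fact quo_display : Order.disp_t. Proof. exact: Order.Disp tt tt. Qed.

HB.instance Definition _ :=
  Order.Le_isPOrder.Build quo_display Quo quo_le_refl quo_le_anti quo_le_trans.

Lemma quo_leE f g : (\pi_Quo f <= \pi_Quo g) <-> epi_le f g.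
Proof.
have [rf fr] := repr_sim f; have [rg gr] := repr_sim g.
split=> [/asboolP le_r | fg].
  exact: epi_le_trans (epi_le_trans fr le_r) rg.
by apply/asboolP; exact: epi_le_trans (epi_le_trans rf fg) gr.
Qed.

End Quotients.

Section Congruences.
Variables (L : language) (M : Lstr L).

Definition is_equivalence (theta : set (M * M)) : Prop :=
  [/\ forall x, theta (x, x),
      forall x y, theta (x, y) -> theta (y, x) &
      forall x y z, theta (x, y) -> theta (y, z) -> theta (x, z)].

Definition is_congruence (theta : set (M * M)) : Prop :=
  [/\ is_equivalence theta,
      forall (F : fsym L) (x y : 'I_(farity F) -> M),
        (forall i, theta (x i, y i)) -> theta (fint M F x, fint M F y) &
      forall (R : rsym L) (x y : 'I_(rarity R) -> M),
        (forall i, theta (x i, y i)) -> (rint M R x <-> rint M R y)].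

Record Con := MkCon {
  con_set :> set (M * M);
  con_setP : `[< is_congruence con_set >] }.

HB.instance Definition _ := [isSub for con_set].
HB.instance Definition _ := [Choice of Con by <:].

Fact con_display : Order.disp_t. Proof. exact: Order.Disp tt tt. Qed.

HB.instance Definition _ := [SubChoice_isSubPOrder of Con by <: with con_display].

Lemma con_leE (theta eta : Con) :
  (theta <= eta) <-> (con_set theta `<=` con_set eta).
Proof. by split=> /asboolP. Qed.

Definition ker_set (N : Lstr L) (f : shom M N) : set (M * M) :=
  [set p | f p.1 = f p.2].

Lemma ker_congruence (N : Lstr L) (f : shom M N) : is_congruence (ker_set f).
Proof.
case: f => f [fF fR]; rewrite /ker_set; split=> /=.
- by split=> //= x y z -> ->.
- by move=> F x y /= xy; rewrite !fF; congr (fint N F _); apply: funext.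
move=> R x y /= xy; rewrite !fR.
by have -> : (fun i => f (x i)) = (fun i => f (y i)) by apply: funext.
Qed.

Definition ker (N : Lstr L) (f : shom M N) : Con :=
  MkCon (introT (asboolP _) (ker_congruence f)).

End Congruences.

(* Meets and joins are taken order-theoretically, so that being a lattice is a
   property of the ordered type, not operations bundled with it as in
   [latticeType]. *)
Definition is_lattice d (T : porderType d) : Prop :=
  forall x y : T,
    infimums [set x; y] !=set0 /\ supremums [set x; y] !=set0.

Definition is_lattice_iso d (S : porderType d) d' (T : porderType d')
    (phi : S -> T) : Prop :=
  [/\ bijective phi,
      forall x y m : S,
        infimums [set x; y] m -> infimums [set phi x; phi y] (phi m) &
      forall x y j : S,
        supremums [set x; y] j -> supremums [set phi x; phi y] (phi j)].

(* Main.v *)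
(* A congruence theta is the kernel of the projection onto M / theta, and
   f <= g iff ker f is included in ker g, since g then factors through any
   section of f; so [f] |-> ker f is an order isomorphism.  The meet of two
   congruences is their intersection.  Their join is the transitive closure of
   their union: arities being finite, one can pass from a tuple to another
   one by changing a single coordinate at a time. *)

Require Import Defs.
From mathcomp Require Import all_boot all_order.
From mathcomp Require Import generic_quotient boolp classical_sets.
From Stdlib Require Import Relation_Operators.

Set Implicit Arguments.
Unset Strict Implicit.
Unset Printing Implicit Defensive.

Import Order.TTheory.

Local Open Scope order_scope.
Local Open Scope classical_set_scope.

(** * Meets and joins of pairs in a partial order *)

Lemma lbound2P d (T : porderType d) (x y m : T) :
  lbound [set x; y] m <-> m <= x /\ m <= y.
Proof.
split=> [lbm | [mx my] z [->|->] //].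
by split; apply: lbm; [left | right].
Qed.

Lemma ubound2P d (T : porderType d) (x y m : T) :
  ubound [set x; y] m <-> x <= m /\ y <= m.
Proof.
split=> [ubm | [mx my] z [->|->] //].
by split; apply: ubm; [left | right].
Qed.

Lemma infimums2P d (T : porderType d) (x y m : T) :
  infimums [set x; y] m <->
  [/\ m <= x, m <= y & forall z, z <= x -> z <= y -> z <= m].
Proof.
split=> [[/lbound2P[mx my] glb] | [mx my glb]].
  by split=> // z zx zy; apply: glb; apply/lbound2P.
by split; [apply/lbound2P | move=> z /lbound2P[]; exact: glb].
Qed.

Lemma supremums2P d (T : porderType d) (x y j : T) :
  supremums [set x; y] j <->
  [/\ x <= j, y <= j & forall z, x <= z -> y <= z -> j <= z].
Proof.
split=> [[/ubound2P[xj yj] lub] | [xj yj lub]].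
  by split=> // z xz yz; apply: lub; apply/ubound2P.
by split; [apply/ubound2P | move=> z /ubound2P[]; exact: lub].
Qed.

(** * Transport along an order isomorphism *)

Section OrderIso.
Variables (d d' : Order.disp_t) (S : porderType d) (T : porderType d').
Variables (phi : S -> T) (psi : T -> S).
Hypotheses (phiK : cancel phi psi) (psiK : cancel psi phi).
Hypothesis (phi_le : {mono phi : x y / x <= y}).

Lemma order_iso_infimums x y m :
  infimums [set phi x; phi y] (phi m) <-> infimums [set x; y] m.
Proof.
split=> /infimums2P[mx my glb]; apply/infimums2P; split.
- by rewrite -phi_le.
- by rewrite -phi_le.
- by move=> z zx zy; rewrite -phi_le; apply: glb; rewrite phi_le.
- by rewrite phi_le.
- by rewrite phi_le.
- by move=> z; rewrite -[z]psiK !phi_le; exact: glb.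
Qed.

Lemma order_iso_supremums x y j :
  supremums [set phi x; phi y] (phi j) <-> supremums [set x; y] j.
Proof.
split=> /supremums2P[xj yj lub]; apply/supremums2P; split.
- by rewrite -phi_le.
- by rewrite -phi_le.
- by move=> z xz yz; rewrite -phi_le; apply: lub; rewrite phi_le.
- by rewrite phi_le.
- by rewrite phi_le.
- by move=> z; rewrite -[z]psiK !phi_le; exact: lub.
Qed.

Lemma order_iso_lattice_iso : is_lattice_iso phi.
Proof.
split; first by exists psi.
  by move=> x y m /order_iso_infimums.
by move=> x y j /order_iso_supremums.
Qed.

(** Meets and joins of quotients are obtained this way from those of congruences, by pulling back
    along [phi]. *)
Lemma order_iso_is_lattice : is_lattice T -> is_lattice S.
Proof.
move=> latT x y; have [[m infm] [j supj]] := latT (phi x) (phi y).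
split; [exists (psi m) | exists (psi j)].
  by apply/order_iso_infimums; rewrite psiK.
by apply/order_iso_supremums; rewrite psiK.
Qed.

End OrderIso.

(** * Auxiliary facts on sets: epimorphisms and closures of relations *)

Lemma set_epi_surj (A B : Type) (f : A -> B) :
  set_epi f -> forall b, exists a, f a = b.
Proof.
move=> epi_f b.
(* The image of [f] and the whole of [B], as maps to [Prop], agree after composition with [f], so
   the epimorphism identifies them. *)
have /(congr1 (@^~ b)) : (fun b => exists a, f a = b) = (fun=> True).
  by apply: epi_f; apply/funext=> a /=; apply/propext; split=> // _; exists a.
by move=> ->.
Qed.

Lemma surj_set_epi (A B : Type) (f : A -> B) (s : B -> A) :
  cancel s f -> set_epi f.
Proof.
move=> sK Z g h gh; apply/funext=> b; rewrite -(sK b).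
exact: (congr1 (@^~ (s b)) gh).
Qed.

(** Chains in different coordinates may have different lengths, so they are followed one coordinate
    after another. Keeping [S] abstract lets one argument serve function and relation symbols
    alike. *)
Lemma clos_coordinatewise (T : Type) (U : T -> T -> Prop) n
    (S : ('I_n -> T) -> ('I_n -> T) -> Prop) :
  (forall x, S x x) -> (forall y x z, S x y -> S y z -> S x z) ->
  (forall x y, (forall i, x i = y i \/ U (x i) (y i)) -> S x y) ->
  forall x y, (forall i, clos_refl_trans T U (x i) (y i)) -> S x y.
Proof.
move=> Srefl Strans Sstep x y xy.
(* Hybrid tuples from [x] (at [k = 0]) to [y] (at [k = n]); [z k] and [z k.+1] differ at most in
   coordinate [k]. *)
pose z k (i : 'I_n) := if (i < k)%N then y i else x i.
have Sz k : (k <= n)%N -> S x (z k).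
  elim: k => [_ | k IHk lt_kn]; first exact: Srefl.
  apply: (Strans) (IHk (ltnW lt_kn)) _; pose k' := Ordinal lt_kn.
  pose w c i := if i == k' then c else z k i.
  have -> : z k = w (x k').
    by apply/funext=> i; rewrite /w /z; case: eqP => [-> | //]; rewrite ltnn.
  have -> : z k.+1 = w (y k').
    apply/funext=> i; rewrite /w /z; case: eqP => [-> | /eqP].
      by rewrite leqnn.
    by rewrite -val_eqE ltnS leq_eqVlt /= => /negPf->.
  (* Each step of the chain from [x k'] to [y k'] is lifted to tuples by [w], the other coordinates
     staying fixed. *)
  elim: (xy k') => [a b ab | a | a b c _ Sab _ Sbc].
  - by apply: Sstep => i; rewrite /w; case: eqP => _; [right | left].
  - exact: Srefl.
  - exact: (Strans) Sbc.
have -> : y = z n by apply/funext=> i; rewrite /z ltn_ord.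
exact: Sz.
Qed.

(** * The lattice of congruences *)

Section CongruenceLattice.
Variables (L : language) (M : Lstr L).
Implicit Types theta eta : Con M.

Lemma conP theta : is_congruence theta.
Proof. exact/asboolP/con_setP. Qed.

Lemma con_meet_congruence theta eta : is_congruence (theta `&` eta).
Proof.
have [[r1 s1 t1] F1 R1] := conP theta; have [[r2 s2 t2] F2 R2] := conP eta.
split; first split.
- by move=> x; split.
- by move=> x y [? ?]; split; auto.
- by move=> x y z [? ?] [? ?]; split; [exact: (t1 x y) | exact: (t2 x y)].
- by move=> F x y xy; split; [apply: F1 | apply: F2] => i; have [] := xy i.
- by move=> R x y xy; apply: R1 => i; have [] := xy i.
Qed.

Definition con_meet theta eta : Con M :=
  MkCon (introT (asboolP _) (con_meet_congruence theta eta)).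

Definition con_join_set theta eta : set (M * M) :=
  [set p |
    clos_refl_trans M (fun x y => (con_set theta `|` eta) (x, y)) p.1 p.2].

Lemma con_join_ind theta eta n (S : ('I_n -> M) -> ('I_n -> M) -> Prop) :
  (forall x, S x x) -> (forall y x z, S x y -> S y z -> S x z) ->
  (forall x y : 'I_n -> M, (forall i, con_set theta (x i, y i)) -> S x y) ->
  (forall x y : 'I_n -> M, (forall i, con_set eta (x i, y i)) -> S x y) ->
  forall x y : 'I_n -> M, (forall i, con_join_set theta eta (x i, y i)) ->
  S x y.
Proof.
have [[r1 _ _] _ _] := conP theta; have [[r2 _ _] _ _] := conP eta.
move=> Srefl Strans S1 S2 x y; apply: clos_coordinatewise => // {}x {}y xy.
(* A mixed step from [x] to [y] splits at [z]: first the coordinates related by [theta] are changed,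
   then the remaining ones, which are equal or related by [eta]. *)
pose z i := if `[< con_set theta (x i, y i) >] then y i else x i.
apply: (Strans z); [apply: S1 | apply: S2] => i; rewrite /z;
  case: asboolP => //.
by case: (xy i) => [-> _ | []].
Qed.

Lemma con_join_congruence theta eta : is_congruence (con_join_set theta eta).
Proof.
have [[r1 s1 t1] F1 R1] := conP theta; have [[r2 s2 t2] F2 R2] := conP eta.
split; first split.
- by move=> x; exact: rt_refl.
- move=> x y; rewrite /con_join_set /=.
  elim=> [a b [ab | ab] | a | a b c _ ba _ cb]; last exact: rt_trans ba.
  + by apply: rt_step; left; exact: s1.
  + by apply: rt_step; right; exact: s2.
  + exact: rt_refl.
- by move=> x y z; exact: rt_trans.
- move=> F; apply: con_join_ind => [x | y x z | x y xy | x y xy].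
  + exact: rt_refl.
  + exact: rt_trans.
  + by apply: rt_step; left; exact: F1.
  + by apply: rt_step; right; exact: F2.
- move=> R; apply: con_join_ind => [// | y x z [xy yx] [yz zy] | |].
  + by split=> [/xy/yz | /zy/yx].
  + exact: R1.
  + exact: R2.
Qed.

Definition con_join theta eta : Con M :=
  MkCon (introT (asboolP _) (con_join_congruence theta eta)).

Lemma Con_is_lattice : is_lattice (Con M).
Proof.
move=> theta eta; split.
  exists (con_meet theta eta); apply/infimums2P; split.
  - by apply/con_leE => p [].
  - by apply/con_leE => p [].
  - by move=> z /con_leE z1 /con_leE z2; apply/con_leE => p zp; split; auto.
exists (con_join theta eta); apply/supremums2P; split.
- by apply/con_leE => -[x y] xy; apply: rt_step; left.
- by apply/con_leE => -[x y] xy; apply: rt_step; right.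
move=> z /con_leE z1 /con_leE z2; apply/con_leE => -[x y].
have [[rz _ tz] _ _] := conP z; rewrite /= /con_join_set /=.
elim=> [a b [/z1 | /z2] // | a | a b c _ ab _ bc]; first exact: rz.
exact: tz bc.
Qed.

End CongruenceLattice.

(** * The quotient of a structure by a congruence *)

Section QuotientStructure.
Variables (L : language) (M : Lstr L) (theta : Con M).

(** [{classic M}] gives [M] the choice structure from which canonical representatives are taken. *)
Let conb : rel {classic M} := fun x y => `[< con_set theta (x, y) >].

Let conb_refl : reflexive conb.
Proof. by have [[r _ _] _ _] := conP theta => x; apply/asboolP. Qed.

Let conb_sym : symmetric conb.
Proof.
have [[_ s _] _ _] := conP theta => x y.
by apply/asboolP/asboolP; exact: s.
Qed.

Let conb_trans : transitive conb.
Proof.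
have [[_ _ t] _ _] := conP theta => y x z /asboolP xy /asboolP yz.
by apply/asboolP; exact: t yz.
Qed.

Let con_equiv := EquivRel conb conb_refl conb_sym conb_trans.

Let rep (x : M) : M := repr (\pi_({eq_quot con_equiv})%qT (x : {classic M})).

Let repE x y : rep x = rep y <-> con_set theta (x, y).
Proof.
split=> [/(can_inj (@reprK _ _))/eqmodP/asboolP // | xy].
by congr repr; apply/eqmodP/asboolP.
Qed.

Let rep_idem x : rep (rep x) = rep x.
Proof. by rewrite /rep reprK. Qed.

(* [{eq_quot _}] lives in a universe too large for the carrier of a structure,
   hence the set of canonical representatives. *)
Let quo_carrier : Type := {x : M | rep x = x}.

Let proj (x : M) : quo_carrier := exist _ (rep x) (rep_idem x).

Let sect (q : quo_carrier) : M := sval q.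

Let sectK : cancel sect proj.
Proof. by case=> x rx; exact: eq_exist. Qed.

Let projE x y : proj x = proj y <-> con_set theta (x, y).
Proof.
split=> [[] /repE // | /repE xy].
exact: eq_exist.
Qed.

Let sect_proj x : con_set theta (sect (proj x), x).
Proof. by apply/projE; rewrite sectK. Qed.

(** Symbols are evaluated on representatives; compatibility of [theta] enters when [proj] is shown
    to be a strong homomorphism. *)
Definition quo_str : Lstr L :=
  @LStr L quo_carrier
    (fun F x => proj (fint M F (sect \o x)))
    (fun R x => rint M R (sect \o x)).

Lemma quo_proj_strong_hom : @strong_hom L M quo_str proj.
Proof.
have [[_ s _] FC RC] := conP theta; split=> [F x | R x] /=.
  by apply/projE/FC => i; apply: s; exact: sect_proj.
by apply: RC => i; apply: s; exact: sect_proj.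
Qed.

Definition quo_proj : epiF M :=
  @EpiF L M quo_str (SHom quo_proj_strong_hom) (surj_set_epi sectK).

Lemma ker_quo_proj : ker quo_proj = theta.
Proof.
apply/val_inj/seteqP; split=> -[x y] /= /projE; exact.
Qed.

End QuotientStructure.

(** * Comparison of quotients with congruences *)

Lemma epi_le_ker (L : language) (M : Lstr L) (f g : epiF M) :
  epi_le f g <-> ker f <= ker g.
Proof.
split=> [[h gE] | /con_leE fg].
  by apply/con_leE => -[x y]; rewrite /= /ker_set gE /= => ->.
have [s sK] := choice (set_epi_surj (@epi_homP _ _ f)).
(* [s (f x)] and [x] have the same image under [f], hence under [g]; so [g \o s] is the required
   factor. *)
have gs x : g (s (f x)) = g x by apply: (fg (_, _)) => /=; exact: sK.
have [fF fR] := shomP f; have [gF gR] := shomP g.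
have hP : strong_hom (g \o s).
  (* As [s] is only a section of sets, [y] is rewritten as [f \o s \o y], so that the homomorphism
     properties of [f] and [g] apply to the tuple [s \o y]. *)
  split=> [F y | R y] /=.
    by rewrite -gF -[RHS]gs fF; congr (g (s (fint _ F _))); exact/funext.
  rewrite -gR fR; have -> // : (fun i => f (s (y i))) = y.
  exact/funext.
by exists (SHom hP); apply: shom_ext => x /=.
Qed.

Theorem theorem3p13 (L : language) (M : Lstr L) :
  is_lattice (Quo M) /\
  is_lattice (Con M) /\
  exists phi : Quo M -> Con M,
    (forall f : epiF M, phi (\pi_(Quo M)%qT f) = ker f) /\
    is_lattice_iso phi.
Proof.
pose phi (q : Quo M) : Con M := ker (repr q).
pose psi theta : Quo M := \pi_(Quo M)%qT (quo_proj theta).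
have phi_pi f : phi (\pi_(Quo M)%qT f) = ker f.
  have [rf fr] := repr_sim f.
  by apply/le_anti/andP; split; apply/epi_le_ker.
have phi_le : {mono phi : p q / p <= q}.
  move=> p q; apply/idP/idP => [/epi_le_ker pq | pq].
    exact/asboolP.
  by apply/epi_le_ker/asboolP.
have psiK : cancel psi phi by move=> theta; rewrite phi_pi ker_quo_proj.
have phiK : cancel phi psi.
  (* By [psiK], [psi (phi q)] and [q] have the same image under [phi], and [phi] reflects the
     order. *)
  by move=> q; apply/le_anti; rewrite -!phi_le psiK lexx.
have latC := @Con_is_lattice L M.
split; first exact: order_iso_is_lattice psiK phi_le latC.
split=> //; exists phi; split=> //.
exact: order_iso_lattice_iso phiK psiK phi_le.
Qed.
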